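(* Let $\phi:\mathbb{R}^d\to\mathbb{R}$ be a convex quadratic function with Hessian $A$, i.e. $\phi(\mathbf{y})=\phi(\mathbf{x})+\langle\nabla\phi(\mathbf{x}),\mathbf{y}-\mathbf{x}\rangle+\frac12\|\mathbf{y}-\mathbf{x}\|_A^2$ for all $\mathbf{x},\mathbf{y}$, with $0\preceq A\preceq L\cdot I$, $L>0$, and let $\phi$ be $\mu$-strongly convex with $\mu>0$ and minimizer $\mathbf{x}^*$. Let $f=\phi+\zeta$ with $|f(\mathbf{x})-\phi(\mathbf{x})|\le\sigma$ for all $\mathbf{x}$, $\sigma\ge0$. Let $\alpha>0$, and for $t=0,\dots,T-1$ let $S_t\in\mathbb{R}^{d\times\ell}$ be a $(\frac14,k,\frac{\delta}{T})$-oblivious sketching matrix for the matrix product, with columns $\mathbf{s}_t^{(i)}$ and with $\ell=\mathcal{O}\left(k+\log\frac{T}{\delta}\right)$, and assume $k>\log\frac{T}{\delta}$. Let $$\mathbf{x}_{t+1}=\mathbf{x}_t-\eta\sum_{i=1}^{\ell}\frac{f(\mathbf{x}_t+\alpha\mathbf{s}_t^{(i)})-f(\mathbf{x}_t-\alpha\mathbf{s}_t^{(i)})}{2\alpha}\,\mathbf{s}_t^{(i)},\qquad \eta=\left(5\|A\|_2+\frac{\mathrm{tr}(A)}{k}\right)^{-1}.$$ Then, to obtain $\mathbf{x}_T$ such that $\phi(\mathbf{x}_T)-\phi(\mathbf{x}^* )\le\epsilon+\frac{3\ell\sigma^2}{\mu\alpha^2}$ with probability $1-\delta$, it suffices to take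 a number of iterations $$T=\mathcal{O}\left(\left(\frac{\|A\|_2}{\mu}+\frac{\mathrm{tr}(A)}{\mu\ell}\right)\log\frac1\epsilon\right),$$ and accordingly the query complexity is $$Q=T\times\ell=\tilde{\mathcal{O}}\left(\left(\frac{\ell\|A\|_2}{\mu}+\frac{\mathrm{tr}(A)}{\mu}\right)\log\frac1\epsilon\right).$$
   Context: Norms: $\|\mathbf{x}\|$ is Euclidean, $\|\mathbf{x}\|_A=\|A^{1/2}\mathbf{x}\|$, $\|\cdot\|_2$ spectral, $\|\cdot\|_F$ Frobenius; $B\preceq C$ means $C-B$ is positive semidefinite. $\mu$-strong convexity: $\phi(\mathbf{y})\ge\phi(\mathbf{x})+\langle\nabla\phi(\mathbf{x}),\mathbf{y}-\mathbf{x}\rangle+\frac{\mu}{2}\|\mathbf{y}-\mathbf{x}\|^2$ for all $\mathbf{x},\mathbf{y}$. Sketching matrix: for $0<\gamma\le1$, $k\ge1$, $\delta>0$, a random matrix $S\in\mathbb{R}^{d\times\ell}$ is an oblivious $(\gamma,k,\delta)$-random sketching matrix for the matrix product if, for any given matrix $B\in\mathbb{R}^{d\times d}$ ($S$ being independent of $B$), with probability at least $1-\delta$, $\|B^\top SS^\top B-B^\top B\|_2\le\gamma\left(\|B\|_2^2+\frac{\|B\|_F^2}{k}\right)$. The matrix $S_t$ is freshly generated at iteration $t$, independently of $\mathbf{x}_t$. Conventions: the $\mathcal{O}(\cdot)$ for $T$ treats the initial gap $\phi(\mathbf{x}_0)-\phi(\mathbf{x}^* )$ as a constant inside the logarithm;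 $\tilde{\mathcal{O}}(\cdot)$ hides constant and $\log\log\frac1\epsilon$ terms. Query complexity is counted as $T\times\ell$ (up to constants, the number of evaluations of $f$). *)

(* Defs.v *)
From HB Require Import structures.
From mathcomp Require Import all_boot all_order all_algebra.
From mathcomp Require Import all_classical all_reals all_analysis.
Import Order.TTheory GRing.Theory Num.Theory.
Import numFieldNormedType.Exports.

Set Implicit Arguments.
Unset Strict Implicit.
Unset Printing Implicit Defensive.

Local Open Scope classical_set_scope.
Local Open Scope ring_scope.

(* The norm carried by 'M[R]_(m, n) in MathComp-Analysis is the max-norm, so
   the Euclidean, spectral and Frobenius norms are introduced here. *)
Definition dotv (R : realType) (d : nat) (u v : 'cV[R]_d) : R :=
  \sum_(i < d) u i 0 * v i 0.

Definition enorm (R : realType) (d : nat) (x : 'cV[R]_d) : R :=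
  Num.sqrt (dotv x x).

(* The supremum ranges over the closed unit ball rather than the unit sphere,
   so that it is over a nonempty set even when n = 0. *)
Definition specnorm (R : realType) (m n : nat) (B : 'M[R]_(m, n)) : R :=
  sup [set enorm (B *m x) | x in [set x : 'cV[R]_n | enorm x <= 1]].

Definition frobnorm (R : realType) (m n : nat) (B : 'M[R]_(m, n)) : R :=
  Num.sqrt (\sum_(i < m) \sum_(j < n) B i j ^+ 2).

Definition psd (R : realType) (d : nat) (B : 'M[R]_d) : Prop :=
  B^T = B /\ forall x : 'cV[R]_d, 0 <= dotv x (B *m x).

Definition loewner_le (R : realType) (d : nat) (B C : 'M[R]_d) : Prop :=
  psd (C - B).

(* A^{1/2}; the default value 0 is only taken when A has no positive
   semidefinite square root, i.e. when A is not positive semidefinite. *)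
Definition sqrtmx (R : realType) (d : nat) (A : 'M[R]_d) : 'M[R]_d :=
  xget 0 [set B : 'M[R]_d | psd B /\ B *m B = A].

Definition wnorm (R : realType) (d : nat) (A : 'M[R]_d) (x : 'cV[R]_d) : R :=
  enorm (sqrtmx A *m x).

(* 'D_v is total; no differentiability hypothesis is needed next to
   [quadratic_with_hessian], whose identity forces phi to be differentiable. *)
Definition grad (R : realType) (d : nat) (phi : 'cV[R]_d -> R)
    (x : 'cV[R]_d) : 'cV[R]_d :=
  \col_(i < d) 'D_(delta_mx i 0) (phi : 'cV[R]_d -> R^o) x.

Definition quadratic_with_hessian (R : realType) (d : nat)
    (phi : 'cV[R]_d -> R) (A : 'M[R]_d) : Prop :=
  forall x y : 'cV[R]_d,
    phi y = phi x + dotv (grad phi x) (y - x) + 2^-1 * wnorm A (y - x) ^+ 2.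

Definition strongly_convex (R : realType) (d : nat) (mu : R)
    (phi : 'cV[R]_d -> R) : Prop :=
  forall x y : 'cV[R]_d,
    phi x + dotv (grad phi x) (y - x) + mu / 2 * enorm (y - x) ^+ 2 <= phi y.

Definition random_mx (R : realType) (disp : measure_display)
    (Omega : measurableType disp) (m n : nat) (X : Omega -> 'M[R]_(m, n)) :
    Prop :=
  forall i j, measurable_fun setT (fun w => X w i j).

(* The Borel sigma-algebra of R^(m x n), generated by the coordinates. *)
Definition borel_mx (R : realType) (m n : nat) : set (set 'M[R]_(m, n)) :=
  <<s [set U | exists i j (V : set R),
         measurable V /\ U = [set M : 'M[R]_(m, n) | V (M i j)]] >>.

Definition independent_mx (R : realType) (disp : measure_display)
    (Omega : measurableType disp) (P : probability Omega R)
    (m n p q : nat) (X : Omega -> 'M[R]_(m, n)) (Y : Omega -> 'M[R]_(p, q)) :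
    Prop :=
  forall (U : set 'M[R]_(m, n)) (V : set 'M[R]_(p, q)),
    borel_mx U -> borel_mx V ->
    P (X @^-1` U `&` Y @^-1` V) = (P (X @^-1` U) * P (Y @^-1` V))%E.

Definition oblivious_sketching (R : realType) (disp : measure_display)
    (Omega : measurableType disp) (P : probability Omega R) (d ell : nat)
    (gamma k delta : R) (S : Omega -> 'M[R]_(d, ell)) : Prop :=
  random_mx S /\
  forall B : 'M[R]_d,
    ((1 - delta)%:E <=
     P [set w | (specnorm (B^T *m S w *m (S w)^T *m B - B^T *m B) <=
                 gamma * (specnorm B ^+ 2 + frobnorm B ^+ 2 / k))%R])%E.

Definition zo_step (R : realType) (d ell : nat) (f : 'cV[R]_d -> R)
    (alpha eta : R) (S : 'M[R]_(d, ell)) (x : 'cV[R]_d) : 'cV[R]_d :=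
  x - eta *: \sum_(i < ell)
    ((f (x + alpha *: col i S) - f (x - alpha *: col i S)) / (2 * alpha))
      *: col i S.

Definition step_size (R : realType) (d : nat) (A : 'M[R]_d) (k : R) : R :=
  (5 * specnorm A + \tr A / k)^-1.

(* Main.v *)
Require Import Defs.
From HB Require Import structures.
From mathcomp Require Import all_boot all_order all_algebra.
From mathcomp Require Import all_classical all_reals all_analysis.
From mathcomp Require Import measurable_realfun ring lra.
Import Order.TTheory GRing.Theory Num.Theory.
Import numFieldNormedType.Exports.

(** The gap phi (x t) - phi xs contracts by a fixed factor at every iteration, up
    to noise, as long as the sketch S t is good for the current iterate; a union
    bound over the T sketches gives the failure probability delta.

    Let H be the square root of A, M = 5 |A| + tr A / k the inverse of the step
    size eta, v = H (x - xs) and g = H v the gradient at x.  As phi is quadratic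
    the difference quotients equal S^T g + e with |e|^2 <= ell sigma^2 / alpha^2,
    and the step is a gradient step preconditioned by S S^T.  If H S S^T H <= M
    and |S^T g|^2 >= |g|^2 / 4, then by the Polyak-Lojasiewicz inequality
    |g|^2 >= 2 mu (phi x - phi xs) the gap is multiplied by 1 - eta mu / 4, with
    an additive error eta/2 ell sigma^2 / alpha^2 ([zo_step_contraction]).
    Iterating, the errors sum up to at most 2 ell sigma^2 / (mu alpha^2), and
    the initial gap becomes smaller than eps after
    O ((|A| / mu + tr A / (mu k)) log (1/eps)) steps; k may be replaced by ell
    because ell = O(k) ([iteration_count]).

    The heart of the proof is that one sketching event, of probability
    1 - delta/T, provides both conditions on S ([sketch_witness]).  It is applied
    to B = H + tau g v^T, where B B^T is A plus a multiple of g g^T: enlarging A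
    in the direction of g by an amount comparable with |A| + tr A / k leaves the
    error bound of the sketch of the same order, but makes this error relative
    to |g|^2 on that direction.

    The matrix B depends on the random iterate x, while a sketching matrix is
    only good for a given B.  The set of bad pairs (x, S) is measurable, because
    a spectral bound can be tested on integer vectors ([bounded_on_int]), and
    each of its sections has probability at most delta/T; independence of x and
    S then gives the same bound for the random pair
    ([independent_section_bound]). *)

Set Implicit Arguments.
Unset Strict Implicit.
Unset Printing Implicit Defensive.

Local Open Scope classical_set_scope.
Local Open Scope ring_scope.

(** * Euclidean inner product and spectral norm *)

Lemma dotvE (R : realType) (d : nat) (u v : 'cV[R]_d) :
  dotv u v = (u^T *m v) 0 0.
Proof. by rewrite mxE; apply: eq_bigr => i _; rewrite mxE. Qed.

Lemma dotvC (R : realType) (d : nat) (u v : 'cV[R]_d) : dotv u v = dotv v u.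
Proof. by apply: eq_bigr => i _; rewrite mulrC. Qed.

Lemma dotvDl (R : realType) (d : nat) (u v w : 'cV[R]_d) :
  dotv (u + v) w = dotv u w + dotv v w.
Proof. by rewrite !dotvE linearD/= mulmxDl mxE. Qed.

Lemma dotvDr (R : realType) (d : nat) (u v w : 'cV[R]_d) :
  dotv u (v + w) = dotv u v + dotv u w.
Proof. by rewrite !dotvE mulmxDr mxE. Qed.

Lemma dotvZl (R : realType) (d : nat) (c : R) (u v : 'cV[R]_d) :
  dotv (c *: u) v = c * dotv u v.
Proof. by rewrite !dotvE linearZ/= -scalemxAl mxE. Qed.

Lemma dotvZr (R : realType) (d : nat) (c : R) (u v : 'cV[R]_d) :
  dotv u (c *: v) = c * dotv u v.
Proof. by rewrite !dotvE -scalemxAr mxE. Qed.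

Lemma dotvNl (R : realType) (d : nat) (u v : 'cV[R]_d) :
  dotv (- u) v = - dotv u v.
Proof. by rewrite -scaleN1r dotvZl mulN1r. Qed.

Lemma dotvNr (R : realType) (d : nat) (u v : 'cV[R]_d) :
  dotv u (- v) = - dotv u v.
Proof. by rewrite -scaleN1r dotvZr mulN1r. Qed.

Definition dotv_lin := (dotvDl, dotvDr, dotvNl, dotvNr, dotvZl, dotvZr).

Lemma dotv_mull (R : realType) (m n : nat) (B : 'M[R]_(m, n))
    (x : 'cV[R]_n) (y : 'cV[R]_m) :
  dotv (B *m x) y = dotv x (B^T *m y).
Proof. by rewrite !dotvE trmx_mul mulmxA. Qed.

Lemma dotvv_ge0 (R : realType) (d : nat) (u : 'cV[R]_d) : 0 <= dotv u u.
Proof. by apply: sumr_ge0 => i _; rewrite -expr2 sqr_ge0. Qed.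

Lemma dotvv_eq0 (R : realType) (d : nat) (u : 'cV[R]_d) :
  dotv u u = 0 -> u = 0.
Proof.
move=> u0; apply/colP => i; rewrite mxE; apply/eqP.
have h j : j \in 'I_d -> 0 <= u j 0 * u j 0 by rewrite -expr2 sqr_ge0.
have /(_ i isT)/eqP := psumr_eq0P h u0.
by rewrite mulf_eq0 orbb.
Qed.

Lemma dotv0r (R : realType) (d : nat) (u : 'cV[R]_d) : dotv u 0 = 0.
Proof. by rewrite -(scale0r u) dotvZr mul0r. Qed.

(** Expand the squared length of (v.v) u - (u.v) v. *)
Lemma cauchy_schwarz (R : realType) (d : nat) (u v : 'cV[R]_d) :
  dotv u v ^+ 2 <= dotv u u * dotv v v.
Proof.
have [v0|v0] := eqVneq (dotv v v) 0.
  by rewrite (dotvv_eq0 v0) !dotv0r mulr0 expr0n.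
have vgt0 : 0 < dotv v v by rewrite lt_neqAle eq_sym v0 dotvv_ge0.
have := dotvv_ge0 (dotv v v *: u - dotv u v *: v).
rewrite !dotv_lin (dotvC v u) => h.
by rewrite -subr_ge0 -(pmulr_rge0 _ vgt0); move: h; congr (_ <= _); ring.
Qed.

Lemma enorm_ge0 (R : realType) (d : nat) (x : 'cV[R]_d) : 0 <= enorm x.
Proof. exact: sqrtr_ge0. Qed.

Lemma enorm_sqr (R : realType) (d : nat) (x : 'cV[R]_d) :
  enorm x ^+ 2 = dotv x x.
Proof. by rewrite sqr_sqrtr// dotvv_ge0. Qed.

Lemma enorm_le (R : realType) (m n : nat) (c : R) (x : 'cV[R]_m)
    (y : 'cV[R]_n) : 0 <= c ->
  (enorm x <= c * enorm y) = (dotv x x <= c ^+ 2 * dotv y y).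
Proof.
move=> c0; rewrite -!enorm_sqr -exprMn ler_pXn2r// nnegrE ?enorm_ge0//.
by rewrite mulr_ge0// enorm_ge0.
Qed.

(** The supremum defining [specnorm] is over a bounded set: by Cauchy-Schwarz on
    each row, the squared Frobenius norm is an admissible K. *)
Lemma mulmx_bounded (R : realType) (m n : nat) (B : 'M[R]_(m, n)) :
  exists2 K : R, 0 <= K &
    forall x : 'cV[R]_n, dotv (B *m x) (B *m x) <= K * dotv x x.
Proof.
pose r i := (row i B)^T.
exists (\sum_i dotv (r i) (r i)).
  by apply: sumr_ge0 => i _; exact: dotvv_ge0.
move=> x; rewrite mulr_suml; apply: ler_sum => i _.
apply: le_trans (cauchy_schwarz _ _); rewrite -expr2.
suff -> : (B *m x) i 0 = dotv (r i) x by [].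
by rewrite mxE; apply: eq_bigr => j _; rewrite !mxE.
Qed.

Lemma enorm_mulmx_ball (R : realType) (m n : nat) (B : 'M[R]_(m, n))
    (x : 'cV[R]_n) : enorm x <= 1 -> enorm (B *m x) <= specnorm B.
Proof.
have [K K0 hK] := mulmx_bounded B.
move=> x1; apply: ub_le_sup; last by exists x.
exists (Num.sqrt K) => _ [z /= z1 <-].
apply: (@le_trans _ _ (Num.sqrt K * enorm z)).
  by rewrite enorm_le ?sqrtr_ge0// sqr_sqrtr.
by rewrite ler_piMr// sqrtr_ge0.
Qed.

Lemma specnorm_ge0 (R : realType) (m n : nat) (B : 'M[R]_(m, n)) :
  0 <= specnorm B.
Proof.
apply: le_trans (enorm_ge0 (B *m 0)) _; apply: enorm_mulmx_ball.
by rewrite /enorm dotv0r sqrtr0.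
Qed.

Lemma enorm_mulmx (R : realType) (m n : nat) (B : 'M[R]_(m, n))
    (x : 'cV[R]_n) : enorm (B *m x) <= specnorm B * enorm x.
Proof.
have [x0|x0] := eqVneq (dotv x x) 0.
  by rewrite (dotvv_eq0 x0) mulmx0 /enorm !dotv0r sqrtr0 mulr0.
have xgt0 : 0 < enorm x by rewrite sqrtr_gt0 lt_neqAle eq_sym x0 dotvv_ge0.
have ZE c m' (y : 'cV[R]_m') : 0 <= c -> enorm (c *: y) = c * enorm y.
  move=> c0; rewrite /enorm dotvZl dotvZr mulrA -expr2 sqrtrM ?sqr_ge0//.
  by rewrite sqrtr_sqr ger0_norm.
have := @enorm_mulmx_ball _ _ _ B ((enorm x)^-1 *: x).
rewrite -scalemxAr !ZE ?invr_ge0 ?enorm_ge0// mulVf ?gt_eqF// => /(_ (lexx _)).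
by rewrite mulrC ler_pdivrMr.
Qed.

(** Squaring removes the supremum and the square roots: the spectral norm is
    used below only through bounds between quadratic forms. *)
Lemma specnorm_leP (R : realType) (m n : nat) (B : 'M[R]_(m, n)) (c : R) :
  0 <= c ->
  (specnorm B <= c) <->
  (forall x : 'cV[R]_n, dotv (B *m x) (B *m x) <= c ^+ 2 * dotv x x).
Proof.
move=> c0; split=> [Bc x|Bc].
  rewrite -enorm_le//; apply: le_trans (enorm_mulmx _ _) _.
  by rewrite ler_wpM2r// enorm_ge0.
apply: ge_sup; first by exists (enorm (B *m 0)), 0; rewrite //= /enorm dotv0r sqrtr0.
move=> _ [x /= x1 <-]; apply: (@le_trans _ _ (c * enorm x)).
  by rewrite enorm_le.
by rewrite ler_piMr.
Qed.

Lemma dotv_specnorm (R : realType) (d : nat) (E : 'M[R]_d) (x : 'cV[R]_d) :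
  `|dotv x (E *m x)| <= specnorm E * dotv x x.
Proof.
have s0 := specnorm_ge0 E; have x0 := dotvv_ge0 x.
have /specnorm_leP -/(_ s0 x) h : specnorm E <= specnorm E by [].
rewrite -(@ler_pXn2r _ 2)// ?nnegrE ?mulr_ge0//.
rewrite real_normK ?num_real//; apply: le_trans (cauchy_schwarz _ _) _.
by rewrite exprMn [_ ^+ 2 * _]mulrC expr2 -mulrA ler_wpM2l// mulrC.
Qed.

(** A matrix and its transpose have the same spectral norm: with z = B^T y, the
    squared length of z is y.(B z), to which Cauchy-Schwarz applies. *)
Lemma trmx_bounded (R : realType) (m n : nat) (B : 'M[R]_(m, n)) (c : R) :
  (forall x : 'cV[R]_n, dotv (B *m x) (B *m x) <= c * dotv x x) -> 0 <= c ->
  forall y : 'cV[R]_m, dotv (B^T *m y) (B^T *m y) <= c * dotv y y.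
Proof.
move=> hB c0 y; set N := dotv _ _.
have N0 : 0 <= N by exact: dotvv_ge0.
have y0 := dotvv_ge0 y.
have [->|Nn0] := eqVneq N 0; first exact: mulr_ge0.
have Ngt0 : 0 < N by rewrite lt_neqAle eq_sym Nn0.
have : N ^+ 2 <= dotv y y * (c * N).
  rewrite {1}/N dotv_mull trmxK; apply: le_trans (cauchy_schwarz _ _) _.
  by rewrite ler_wpM2l.
by rewrite expr2 mulrA ler_pM2r// mulrC.
Qed.

(** A quadratic form that is nonnegative on integer vectors is nonnegative
    everywhere, since N x is at bounded distance from an integer vector and the
    form grows like N^2 along x while the rounding costs only O(N).  This turns
    a spectral bound into countably many polynomial inequalities, which is how
    such bounds are shown to be measurable events. *)
Lemma bounded_on_int (R : realType) (m n : nat) (B : 'M[R]_(m, n)) (c : R) :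
  0 <= c ->
  (forall z : 'cV[int]_n, let x := map_mx intr z in
     dotv (B *m x) (B *m x) <= c * dotv x x) ->
  forall x : 'cV[R]_n, dotv (B *m x) (B *m x) <= c * dotv x x.
Proof.
move=> c0 hz x; have [K K0 hK] := mulmx_bounded B.
(* N D bounds the loss from rounding N x to an integer vector: the squared
   rounding error is at most n, and mixed terms are split by 2 u.v <= u.u + v.v. *)
pose D := (c + K) * (dotv x x + n%:R) + c * n%:R.
have x0 := dotvv_ge0 x.
have D0 : 0 <= D by rewrite addr_ge0// mulr_ge0// addr_ge0.
have key (N : nat) : (0 < N)%N ->
    (dotv (B *m x) (B *m x) - c * dotv x x) * N%:R <= D.
  move=> N0; have N1 : (1 <= N%:R :> R) by rewrite ler1n.
  have Ngt0 : 0 < N%:R :> R by rewrite ltr0n.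
  pose z := map_mx Num.floor (N%:R *: x).
  pose r := N%:R *: x - map_mx intr z.
  have r_le : dotv r r <= n%:R.
    apply: (@le_trans _ _ (\sum_(i < n) 1)); last by rewrite sumr_const card_ord.
    apply: ler_sum => i _.
    rewrite !mxE; set t := N%:R * x i 0.
    have := floorD1_gt t; rewrite intrD; have := ge_floor t.
    set u := (Num.floor t)%:~R => h1 h2.
    have h3 : 0 <= t - u by rewrite subr_ge0.
    have h4 : t - u <= 1 by rewrite lerBlDl ltW.
    by rewrite -[leRHS]mulr1; apply: ler_pM.
  have zE : map_mx intr z = N%:R *: x - r by rewrite /r opprB addrC subrK.
  clearbody r; have /= := hz z; rewrite zE mulmxBr -scalemxAr !dotv_lin.
  rewrite (dotvC r x) (dotvC (B *m r) (B *m x)).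
  set p := dotv (B *m x) (B *m x); set q := dotv (B *m x) (B *m r).
  set s := dotv (B *m r) (B *m r); set a := dotv x r => main.
  have s0 : 0 <= s by exact: dotvv_ge0.
  have hx := hK x; have hr := hK r.
  have hq : q <= (p + s) / 2.
    have := dotvv_ge0 (B *m x - B *m r).
    rewrite !dotv_lin (dotvC (B *m r) (B *m x)) -/p -/q -/s; lra.
  have ha : - a <= (dotv x x + dotv r r) / 2.
    have := dotvv_ge0 (x + r).
    rewrite !dotv_lin (dotvC r x) -/a; lra.
  have cr : c * dotv r r <= c * n%:R by rewrite ler_wpM2l.
  have Kr : K * dotv r r <= K * n%:R by rewrite ler_wpM2l.
  have hca : - (c * a) <= c * (dotv x x + n%:R) / 2.
    have : c * - a <= c * ((dotv x x + dotv r r) / 2) by rewrite ler_wpM2l.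
    lra.
  have hqa : q - c * a <= (c + K) * (dotv x x + n%:R) / 2.
    rewrite -/p in hx; rewrite -/s in hr; lra.
  have hNN : N%:R * (2 * (q - c * a)) <= N%:R * ((c + K) * (dotv x x + n%:R)).
    by rewrite ler_pM2l//; lra.
  have hcn : c * n%:R <= N%:R * (c * n%:R).
    by rewrite ler_peMl// mulr_ge0.
  rewrite -(ler_pM2l Ngt0) /D; nra.
rewrite -subr_le0; apply/ler_addgt0Pr => e e0; rewrite add0r.
have [//|egt] := leP; exfalso.
pose N := (Num.truncn (D / e)).+1.
have := key N isT; apply/negP; rewrite -ltNge.
apply: (@lt_le_trans _ _ (e * N%:R)).
  by rewrite mulrC -ltr_pdivrMr// /N truncnS_gt.
by rewrite ler_pM2r ?ltr0n// ltW.
Qed.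

(** * Rank-one reweighting and the sketching event *)

Lemma tr_outer (R : realType) (d : nat) (u w : 'cV[R]_d) :
  \tr (u *m w^T) = dotv u w.
Proof. by rewrite mxtrace_mulC /mxtrace big_ord1 dotvC dotvE. Qed.

Lemma frobnorm_sqr (R : realType) (m n : nat) (B : 'M[R]_(m, n)) :
  frobnorm B ^+ 2 = \tr (B *m B^T).
Proof.
rewrite /frobnorm sqr_sqrtr; last first.
  by apply: sumr_ge0 => i _; apply: sumr_ge0 => j _; exact: sqr_ge0.
apply: eq_bigr => i _; rewrite mxE; apply: eq_bigr => j _.
by rewrite mxE expr2.
Qed.

Lemma mulmx_outer (R : realType) (m n : nat) (g : 'cV[R]_m) (v x : 'cV[R]_n) :
  g *m v^T *m x = dotv v x *: g.
Proof.
rewrite -mulmxA; have -> : v^T *m x = (dotv v x)%:M.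
  by apply/matrixP => i j; rewrite !ord1 dotvE [RHS]mxE.
by rewrite mul_mx_scalar.
Qed.

(** The weight tau of the rank-one term of the matrix B = H + tau g v^T used in
    [sketch_witness], where N = v.v, G = g.g and g = H v.  The equation on
    s = 1 + tau N says, for v nonzero, that the coefficient of g g^T in B B^T is
    lam / G, so that B B^T exceeds H^2 by lam in the direction of g; lam then
    enters both squared norms of B additively, whatever the length of v. *)
Lemma rank_one_weight (R : realType) (N G lam : R) :
  0 <= N -> 0 <= G -> 0 <= lam -> (G = 0 -> N = 0) ->
  exists tau, let s := 1 + tau * N in
    [/\ 0 <= tau, s ^+ 2 * G = G + lam * N
      & (2 * tau + tau ^+ 2 * N) * G <= lam].
Proof.
move=> N0 G0 lam0 GN; have [->|Nn0] := eqVneq N 0.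
  by exists 0; split=> //; rewrite !mulr0 ?addr0 ?expr1n ?mul1r ?mul0r.
have Gn0 : G != 0 by apply: contra_neq Nn0.
have x0 : 0 <= lam * N / G by rewrite divr_ge0 ?mulr_ge0.
pose s := Num.sqrt (1 + lam * N / G).
have s2 : s ^+ 2 = 1 + lam * N / G by rewrite sqr_sqrtr// addr_ge0.
have s1 : 1 <= s by rewrite -sqrtr1 ler_wsqrtr// lerDl.
exists ((s - 1) / N); split.
- by rewrite divr_ge0// subr_ge0.
- by rewrite divfK// addrCA subrr addr0 s2; field.
- suff -> : (2 * ((s - 1) / N) + ((s - 1) / N) ^+ 2 * N) * G
    = (s ^+ 2 - 1) / N * G by rewrite s2 addrC addKr le_eqVlt; apply/orP; left;
    apply/eqP; field; apply/andP.
  by field.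
Qed.

Lemma dotv_sqr_specnorm (R : realType) (d : nat) (H : 'M[R]_d)
    (x : 'cV[R]_d) : H^T = H ->
  dotv (H *m x) (H *m x) <= specnorm (H *m H) * dotv x x.
Proof.
move=> Hs; rewrite dotv_mull Hs mulmxA.
exact: le_trans (ler_norm _) (dotv_specnorm _ _).
Qed.

(** The error of a sketched matrix product, tested on a vector x, is the error
    that the sketch makes on the squared length of B x. *)
Lemma sketch_quad (R : realType) (d ell : nat) (B : 'M[R]_d)
    (S : 'M[R]_(d, ell)) (r : R) (x : 'cV[R]_d) :
  specnorm (B^T *m S *m S^T *m B - B^T *m B) <= r ->
  `|dotv (S^T *m (B *m x)) (S^T *m (B *m x)) - dotv (B *m x) (B *m x)|
    <= r * dotv x x.
Proof.
move=> h; apply: (@le_trans _ _ (specnorm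
    (B^T *m S *m S^T *m B - B^T *m B) * dotv x x)); last first.
  by rewrite ler_wpM2r// dotvv_ge0.
apply: le_trans (dotv_specnorm _ _); rewrite mulmxBl dotvDr dotvNr.
by rewrite dotv_mull trmxK [in leLHS]dotv_mull (dotv_mull B) !mulmxA.
Qed.

(** One approximate matrix product controls a step of the method.  A step needs
    that S preserves the length of the gradient g = H v up to a constant, and
    that H S S^T H is at most 1 / eta.  Requesting two sketching events would
    double the failure probability, so both facts are read off a single matrix B
    whose range contains g with a large weight and through which H factors:
    - B v = s g, so that the error on g is at most r (v.v) / s^2, where r is the
      bound given by the sketch; since r <= 3/4 lam and s^2 G = G + lam N, this
      is at most 3/4 of g.g;
    - H = B (I - tau / s v v^T), whose second factor is a contraction, so that
      S^T H is bounded by the norm of H^2 plus r.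
    The weight lam = a + b balances the two requirements. *)
Lemma sketch_witness (R : realType) (d : nat) (H : 'M[R]_d) (v : 'cV[R]_d)
    (k : R) (a := specnorm (H *m H)) (b := \tr (H *m H) / k) :
  H^T = H -> 1 <= k -> (H *m v = 0 -> v = 0) ->
  exists B : 'M[R]_d, forall (ell : nat) (S : 'M[R]_(d, ell)),
    specnorm (B^T *m S *m S^T *m B - B^T *m B)
      <= 1 / 4 * (specnorm B ^+ 2 + frobnorm B ^+ 2 / k) ->
    dotv (H *m v) (H *m v) / 4 <= dotv (S^T *m (H *m v)) (S^T *m (H *m v)) /\
    forall q : 'cV[R]_ell,
      dotv (H *m S *m q) (H *m S *m q) <= (5 * a + b) * dotv q q.
Proof.
move=> Hs k1 inj; set g := H *m v.
have k0 : 0 < k by apply: lt_le_trans k1.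
have a0 : 0 <= a by exact: specnorm_ge0.
have trE : \tr (H *m H) = frobnorm H ^+ 2 by rewrite frobnorm_sqr Hs.
have b0 : 0 <= b by rewrite divr_ge0 ?(ltW k0)// trE sqr_ge0.
pose N := dotv v v; pose G := dotv g g; pose lam := a + b.
have N0 : 0 <= N by exact: dotvv_ge0.
have G0 : 0 <= G by exact: dotvv_ge0.
have lam0 : 0 <= lam by exact: addr_ge0.
have GN : G = 0 -> N = 0.
  by move=> /dotvv_eq0 /inj v0; rewrite /N v0 dotv0r.
have [tau [tau0 sG tG]] := rank_one_weight N0 G0 lam0 GN.
set s := 1 + tau * N in sG; have s1 : 1 <= s by rewrite lerDl mulr_ge0.
have s0 : 0 < s by apply: lt_le_trans s1.
pose B := H + tau *: (g *m v^T).
have BE x : B *m x = H *m x + (tau * dotv v x) *: g.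
  by rewrite mulmxDl -scalemxAl mulmx_outer scalerA.
have BtE x : B^T *m x = H *m x + (tau * dotv g x) *: v.
  rewrite /B linearD linearZ/= trmx_mul trmxK Hs mulmxDl -scalemxAl.
  by rewrite mulmx_outer scalerA.
have gx x : dotv v (H *m x) = dotv g x by rewrite /g dotv_mull Hs.
(* B B^T = H^2 + (2 tau + tau^2 N) g g^T, whose last term has norm at most lam. *)
have normB : specnorm B ^+ 2 <= a + lam.
  have al0 : 0 <= a + lam by exact: addr_ge0.
  suff h : specnorm B <= Num.sqrt (a + lam).
    rewrite -[leRHS]sqr_sqrtr// ler_pXn2r// nnegrE ?sqrtr_ge0//.
    exact: specnorm_ge0.
  apply/specnorm_leP => [|]; first exact: sqrtr_ge0.
  rewrite sqr_sqrtr// -[B]trmxK; apply: trmx_bounded => // y.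
  rewrite BtE !dotv_lin (dotvC (H *m y) v) gx -/N.
  have hy := @dotv_sqr_specnorm _ _ H y Hs; rewrite -/a in hy.
  have cs := cauchy_schwarz g y; rewrite -/G in cs.
  have y0 := dotvv_ge0 y.
  have c0 : 0 <= 2 * tau + tau ^+ 2 * N.
    by rewrite addr_ge0// mulr_ge0// sqr_ge0.
  have h1 : (2 * tau + tau ^+ 2 * N) * dotv g y ^+ 2
      <= (2 * tau + tau ^+ 2 * N) * (G * dotv y y) by rewrite ler_wpM2l.
  have h2 : (2 * tau + tau ^+ 2 * N) * G * dotv y y <= lam * dotv y y.
    by rewrite ler_wpM2r.
  lra.
have frobB : frobnorm B ^+ 2 / k <= b + lam.
  apply: (@le_trans _ _ ((\tr (H *m H) + lam) / k)); last first.
    by rewrite mulrDl -/b lerD2l ler_pdivrMr// ler_peMr.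
  rewrite ler_pM2r ?invr_gt0// frobnorm_sqr.
  have -> : B *m B^T = H *m H + (2 * tau + tau ^+ 2 * N) *: (g *m g^T).
    rewrite /B linearD linearZ/= trmx_mul trmxK Hs mulmxDl !mulmxDr -!scalemxAl.
    rewrite -!scalemxAr scalerA mulmxA -/g.
    have -> : g *m v^T *m H = g *m g^T by rewrite -mulmxA /g trmx_mul Hs.
    have -> : g *m v^T *m (v *m g^T) = N *: (g *m g^T).
      by rewrite mulmxA mulmx_outer -scalemxAl.
    rewrite scalerA -addrA -!scalerDl; congr (_ + _ *: _); ring.
  by rewrite linearD linearZ/= tr_outer lerD2l.
have Bv : B *m v = s *: g.
  by rewrite BE -/g -/N /s scalerDl scale1r.
exists B => ell S hS.
set r := 1 / 4 * _ in hS.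
have r_le : r <= 3 / 4 * lam by rewrite /r; move: normB frobB; rewrite /lam; lra.
split.
  have := sketch_quad v hS; rewrite Bv -scalemxAr !dotv_lin -/N -/G.
  set u := dotv (S^T *m g) _ => /ler_normlP[h _].
  have h2 : r * N <= 3 / 4 * lam * N by rewrite ler_wpM2r.
  have s20 : 0 < s ^+ 2 by rewrite exprn_gt0.
  rewrite -(ler_pM2l s20); move: h sG; rewrite expr2; lra.
(* H S q is bounded through its transpose S^T H, to which the sketch applies. *)
have HS q : H *m S *m q = (S^T *m H)^T *m q by rewrite trmx_mul trmxK Hs.
move=> q; rewrite HS; apply: trmx_bounded; last first.
  by rewrite addr_ge0// mulr_ge0.
move=> {q} y.
(* W is the preimage under B of H y, shorter than y itself. *)
pose W := y - (tau / s * dotv v y) *: v.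
have BW : B *m W = H *m y.
  rewrite BE /W mulmxBr -scalemxAr -/g !dotv_lin -/N -addrA -scaleNr -scalerDl.
  set c := (X in X *: _); suff -> : c = 0 by rewrite scale0r addr0.
  by rewrite /c /s; field; rewrite -/s gt_eqF.
have WW : dotv W W <= dotv y y.
  rewrite /W !dotv_lin -/N (dotvC y v); set p := dotv v y.
    have -> : dotv y y - tau / s * p * p
      + (- (tau / s * p * p) - tau / s * p * - (tau / s * p * N))
       = dotv y y - tau / s * p ^+ 2 * (2 - tau * N / s) by ring.
  rewrite lerBlDr lerDl mulr_ge0//.
    by rewrite mulr_ge0 ?sqr_ge0// divr_ge0// ltW.
  rewrite subr_ge0 ler_pdivrMr// /s; nra.
have := sketch_quad W hS; rewrite BW mulmxA => /ler_normlP[_ h].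
have hy := @dotv_sqr_specnorm _ _ H y Hs; rewrite -/a in hy.
have W0 := dotvv_ge0 W; have y0 := dotvv_ge0 y.
have h1 : r * dotv W W <= 3 / 4 * lam * dotv W W by rewrite ler_wpM2r.
have h2 : lam * dotv W W <= lam * dotv y y by rewrite ler_wpM2l.
have h3 : 0 <= a * dotv y y by rewrite mulr_ge0.
have h4 : 0 <= b * dotv y y by rewrite mulr_ge0.
rewrite /lam in h1 h2; lra.
Qed.

(** * One step on a quadratic function *)

(** The existence of a square root H of A comes from strong convexity: were
    there none, [sqrtmx A] would be 0, phi would be affine, and strong convexity
    would fail.  Rewritten at the minimizer, where the gradient vanishes, the
    hypotheses on phi become statements about H alone, and the gradient of phi
    at x is H (H (x - xs)). *)
Lemma quadratic_root (R : realType) (d : nat) (A : 'M[R]_d) (mu : R)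
    (phi : 'cV[R]_d -> R) (xs : 'cV[R]_d) :
  (0 < d)%N -> quadratic_with_hessian phi A -> strongly_convex mu phi ->
  0 < mu -> (forall y, phi xs <= phi y) ->
  exists H : 'M[R]_d,
    [/\ H^T = H, H *m H = A,
      forall y, phi y = phi xs + 2^-1 * dotv (H *m (y - xs)) (H *m (y - xs))
    & forall z, mu * dotv z z <= dotv (H *m z) (H *m z)].
Proof.
move=> d0 hq hsc mu0 hmin; pose H := sqrtmx A.
have hqH x y : phi y = phi x + dotv (grad phi x) (y - x)
    + 2^-1 * dotv (H *m (y - x)) (H *m (y - x)).
  by rewrite (hq x y) /wnorm enorm_sqr.
have Hmu z : mu * dotv z z <= dotv (H *m z) (H *m z).
  have := hsc xs (z + xs); rewrite (hqH xs (z + xs)) addrK enorm_sqr; lra.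
(* A step of length t against a nonzero gradient g decreases phi, because the
   first-order gain t (g.g) exceeds the second-order term. *)
have gE : grad phi xs = 0.
  apply: dotvv_eq0; set g := grad phi xs; apply/eqP; rewrite eq_le dotvv_ge0 andbT.
  rewrite leNgt; apply/negP => g0.
  set K := dotv (H *m g) (H *m g); have K0 : 0 <= K by exact: dotvv_ge0.
  pose t := dotv g g / (K + 1).
  have K1 : 0 < K + 1 by rewrite ltr_wpDl.
  have t0 : 0 < t by rewrite divr_gt0.
  have := hmin (xs + - t *: g).
  rewrite (hqH xs (xs + _)) [xs + _]addrC addrK -/g -scalemxAr !dotv_lin -/K.
  have : t * K <= dotv g g.
    by rewrite /t mulrAC ler_pdivrMr// ler_pM2l// lerDl.
  nra.
exists H; split=> //; last by move=> y; rewrite (hqH xs y) gE dotvC dotv0r addr0.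
- rewrite /H /sqrtmx; case: xgetP => [B _ [[]]//|_]; exact: trmx0.
- move: Hmu; rewrite /H /sqrtmx; case: xgetP => [B _ [_]//|_ Hmu]; exfalso.
  have := Hmu (delta_mx (Ordinal d0) 0); rewrite mul0mx dotv0r.
  apply/negP; rewrite -ltNge mulr_gt0// lt_neqAle dotvv_ge0 andbT eq_sym.
  apply/eqP => /dotvv_eq0 /colP /(_ (Ordinal d0)); rewrite !mxE !eqxx /=.
  by move/eqP; rewrite oner_eq0.
Qed.

Lemma lincomb_col (R : realType) (d ell : nat) (S : 'M[R]_(d, ell))
    (c : 'I_ell -> R) : \sum_i c i *: col i S = S *m (\col_i c i).
Proof.
apply/colP => j; rewrite summxE mxE; apply: eq_bigr => i _.
by rewrite !mxE mulrC.
Qed.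

(** Central differences are exact on a quadratic function, so that the only
    error comes from the noise, at most sigma / alpha for each direction. *)
Lemma difference_error (R : realType) (d ell : nat) (H : 'M[R]_d)
    (phi f : 'cV[R]_d -> R) (xs x : 'cV[R]_d) (sigma alpha : R)
    (S : 'M[R]_(d, ell)) (g := H *m (H *m (x - xs)))
    (e := \col_i ((f (x + alpha *: col i S) - f (x - alpha *: col i S))
             / (2 * alpha)) - S^T *m g) :
  H^T = H ->
  (forall y, phi y = phi xs + 2^-1 * dotv (H *m (y - xs)) (H *m (y - xs))) ->
  (forall y, `|f y - phi y| <= sigma) -> 0 < alpha ->
  dotv e e <= ell%:R * sigma ^+ 2 / alpha ^+ 2.
Proof.
move=> Hs hphi hf al0.
have -> : ell%:R * sigma ^+ 2 / alpha ^+ 2 = \sum_(i < ell) (sigma / alpha) ^+ 2.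
  by rewrite sumr_const card_ord -mulr_natl; field; rewrite gt_eqF.
apply: ler_sum => i _; rewrite -expr2.
have s0 : 0 <= sigma by apply: le_trans (hf 0).
suff h : `|e i 0| <= sigma / alpha.
  by rewrite -[leLHS]real_normK ?num_real// ler_pXn2r// nnegrE divr_ge0// ltW.
have gi : (S^T *m g) i 0 = dotv (H *m (x - xs)) (H *m col i S).
  rewrite dotvC dotv_mull Hs -/g mxE; apply: eq_bigr => j _.
  by rewrite !mxE.
have -> : e i 0 = ((f (x + alpha *: col i S) - phi (x + alpha *: col i S))
    - (f (x - alpha *: col i S) - phi (x - alpha *: col i S))) / (2 * alpha).
  rewrite /e mxE [X in X + _]mxE [X in _ + X]mxE gi (hphi (x + _)) (hphi (x - _)).
  rewrite ![x + _ - xs]addrAC !(mulmxDr H (x - xs)) mulmxN -scalemxAr.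
  set v := H *m (x - xs); set w := H *m col i S.
  rewrite !dotv_lin (dotvC w v); field; rewrite gt_eqF//.
rewrite normrM normfV [`|2 * _|]gtr0_norm ?mulr_gt0//.
rewrite ler_pdivrMr ?mulr_gt0// (_ : _ * (2 * alpha) = sigma + sigma); last first.
  by field; rewrite gt_eqF.
by apply: le_trans (ler_normB _ _) _; exact: lerD.
Qed.

(** With q = S^T g + e the vector of difference quotients, the step decreases phi
    by eta (S^T g).q up to the second-order term eta^2/2 |H S q|^2 <= eta/2 |q|^2.
    What remains is eta/2 (|e|^2 - |S^T g|^2): the cross terms cancel, and
    |S^T g|^2 >= |g|^2 / 4 >= (mu / 2) (phi x - phi xs). *)
Lemma zo_step_contraction (R : realType) (d ell : nat) (H : 'M[R]_d)
    (phi f : 'cV[R]_d -> R) (xs x : 'cV[R]_d) (mu sigma alpha eta : R)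
    (S : 'M[R]_(d, ell)) (g := H *m (H *m (x - xs))) :
  H^T = H ->
  (forall y, phi y = phi xs + 2^-1 * dotv (H *m (y - xs)) (H *m (y - xs))) ->
  (forall z, mu * dotv z z <= dotv (H *m z) (H *m z)) ->
  (forall y, `|f y - phi y| <= sigma) -> 0 < alpha -> 0 < eta ->
  dotv g g / 4 <= dotv (S^T *m g) (S^T *m g) ->
  (forall q : 'cV[R]_ell,
    dotv (H *m S *m q) (H *m S *m q) <= eta^-1 * dotv q q) ->
  phi (zo_step f alpha eta S x) - phi xs <=
    (1 - eta * mu / 4) * (phi x - phi xs)
    + eta / 2 * (ell%:R * sigma ^+ 2 / alpha ^+ 2).
Proof.
move=> Hs hphi hmu hf al0 eta0 hlow hup.
have := @difference_error _ _ _ H phi f xs x sigma alpha S Hs hphi hf al0.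
rewrite /zo_step lincomb_col -/g; set q := \col_i _; set e := q - _ => /= he.
have qE : q = S^T *m g + e by rewrite /e addrC subrK. clearbody e.
rewrite [phi (x - _)]hphi (hphi x) ![phi xs + _]addrC !addrK.
rewrite addrAC mulmxBr -scalemxAr mulmxA.
have cross : dotv (H *m (x - xs)) (H *m S *m q) = dotv (S^T *m g) q.
  by rewrite [RHS]dotv_mull trmxK [RHS]dotv_mull Hs mulmxA.
have gmu : mu * dotv (H *m (x - xs)) (H *m (x - xs)) <= dotv g g by exact: hmu.
rewrite !dotv_lin (dotvC (H *m S *m q)) cross.
have hq : eta * (eta * dotv (H *m S *m q) (H *m S *m q)) <= eta * dotv q q.
  by rewrite ler_pM2l// -[leRHS](mulVKf (lt0r_neq0 eta0)) ler_pM2l.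
have qq : dotv q q = dotv (S^T *m g) (S^T *m g) + 2 * dotv (S^T *m g) e + dotv e e.
  by rewrite qE !dotv_lin (dotvC e); ring.
have uq : dotv (S^T *m g) q = dotv (S^T *m g) (S^T *m g) + dotv (S^T *m g) e.
  by rewrite qE dotvDr.
have h1 : eta * dotv e e <= eta * (ell%:R * sigma ^+ 2 / alpha ^+ 2).
  by rewrite ler_pM2l.
have h2 : eta * (mu * dotv (H *m (x - xs)) (H *m (x - xs)) / 4)
    <= eta * dotv (S^T *m g) (S^T *m g).
  by rewrite ler_pM2l//; lra.
rewrite qq in hq; rewrite uq; lra.
Qed.

(** * Random matrices *)

(** Conditioning on X: by independence, (X, Y) is distributed as the product of
    the laws of X and Y, so that a bound valid for each fixed value of X
    integrates to the same bound. *)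
Lemma independent_section_bound (R : realType) (d0 d1 d2 : measure_display)
    (Omega : measurableType d0) (T1 : measurableType d1)
    (T2 : measurableType d2) (P : probability Omega R)
    (X : Omega -> T1) (Y : Omega -> T2) (bad : set (T1 * T2)) (e : \bar R) :
  measurable_fun setT X -> measurable_fun setT Y ->
  (forall U V, measurable U -> measurable V ->
    P (X @^-1` U `&` Y @^-1` V) = (P (X @^-1` U) * P (Y @^-1` V))%E) ->
  measurable bad -> (0 <= e)%E ->
  (forall u, P [set w | bad (u, Y w)] <= e)%E ->
  (P [set w | bad (X w, Y w)] <= e)%E.
Proof.
move=> mX mY hXY mbad e0 hbad.
have mXY : measurable_fun setT (fun w => (X w, Y w)).
  exact: measurable_fun_pair.
pose fX : {mfun Omega >-> T1} := mfun_Sub (mem_set mX).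
pose fY : {mfun Omega >-> T2} := mfun_Sub (mem_set mY).
pose fXY : {mfun Omega >-> (T1 * T2)%type} := mfun_Sub (mem_set mXY).
change (distribution P fXY bad <= e)%E.
rewrite -(product_measure_unique (m1 := distribution P fX)
  (m2 := distribution P fY) (m' := distribution P fXY) hXY mbad).
apply: (@le_trans _ _ (\int[distribution P fX]_x (cst e) x)%E).
  apply: ge0_le_integral => //.
  - exact: measurable_fun_xsection.
  - move=> u _ /=; apply: le_trans (hbad u).
    rewrite /distribution /pushforward /=.
    suff -> : Y @^-1` xsection bad u = [set w | bad (u, Y w)] by [].
    by apply/seteqP; split=> w /=; rewrite /xsection /= inE.
rewrite integral_cst//.
have := probability_setT (distribution P fX) => /= ->.
by rewrite mule1.
Qed.

(** The generators of [borel_mx]; the events of [mx_space] are those of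
    [borel_mx] by conversion, which lets matrices be values of measurable
    functions and components of product spaces. *)
Definition coordinate_sets (R : realType) (m n : nat) : set (set 'M[R]_(m, n)) :=
  [set U | exists i j (V : set R),
     measurable V /\ U = [set M : 'M[R]_(m, n) | V (M i j)]].

Definition mx_space (R : realType) (m n : nat) :=
  g_sigma_algebraType (@coordinate_sets R m n).

Lemma random_mxE (R : realType) (disp : measure_display)
    (Omega : measurableType disp) (m n : nat) (X : Omega -> 'M[R]_(m, n)) :
  random_mx X -> measurable_fun setT (X : Omega -> @mx_space R m n).
Proof.
move=> mX.
apply: (@measurability _ _ _ (@mx_space R m n) _ _
  (@coordinate_sets R m n)).
  by [].
move=> _ [_ [i [j [V [mV ->]]]] <-].
exact: mX.
Qed.

Lemma measurable_coordinate (R : realType) (m n : nat) (i : 'I_m) (j : 'I_n) :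
  measurable_fun setT (fun M : @mx_space R m n => M i j).
Proof.
move=> _ V mV; rewrite setTI; apply: sub_sigma_algebra.
by exists i, j, V.
Qed.

Lemma random_mxM (R : realType) (disp : measure_display)
    (Omega : measurableType disp) (m n p : nat)
    (X : Omega -> 'M[R]_(m, n)) (Y : Omega -> 'M[R]_(n, p)) :
  random_mx X -> random_mx Y -> random_mx (fun w => X w *m Y w).
Proof.
move=> mX mY i j; under eq_fun do rewrite mxE.
by apply: measurable_sum => k; exact: measurable_funM.
Qed.

Lemma random_mx_cst (R : realType) (disp : measure_display)
    (Omega : measurableType disp) (m n : nat) (M : 'M[R]_(m, n)) :
  random_mx (fun _ : Omega => M).
Proof. by move=> i j; exact: measurable_cst. Qed.

Lemma random_mxB (R : realType) (disp : measure_display)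
    (Omega : measurableType disp) (m n : nat)
    (X Y : Omega -> 'M[R]_(m, n)) :
  random_mx X -> random_mx Y -> random_mx (fun w => X w - Y w).
Proof.
move=> mX mY i j; under eq_fun do rewrite !mxE.
exact: measurable_funB.
Qed.

Lemma random_mx_tr (R : realType) (disp : measure_display)
    (Omega : measurableType disp) (m n : nat) (X : Omega -> 'M[R]_(m, n)) :
  random_mx X -> random_mx (fun w => (X w)^T).
Proof. by move=> mX i j; under eq_fun do rewrite mxE; exact: mX. Qed.

Lemma measurable_dotvv (R : realType) (disp : measure_display)
    (Omega : measurableType disp) (n : nat) (X : Omega -> 'cV[R]_n) :
  random_mx X -> measurable_fun setT (fun w => dotv (X w) (X w)).
Proof. by move=> mX; apply: measurable_sum => i; exact: measurable_funM. Qed.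

Lemma measurable_le_set (R : realType) (disp : measure_display)
    (Omega : measurableType disp) (f g : Omega -> R) :
  measurable_fun setT f -> measurable_fun setT g ->
  measurable [set w | f w <= g w].
Proof.
move=> mf mg; rewrite -[X in measurable X]setTI.
exact: measurable_fun_le.
Qed.

Lemma measurable_bounded_mx (R : realType) (disp : measure_display)
    (Omega : measurableType disp) (m n : nat) (X : Omega -> 'M[R]_(m, n))
    (c : R) : 0 <= c -> random_mx X ->
  measurable [set w | forall x : 'cV[R]_n,
    dotv (X w *m x) (X w *m x) <= c * dotv x x].
Proof.
move=> c0 mX; pose F (z : 'cV[int]_n) := [set w | let x := map_mx intr z in
  dotv (X w *m x) (X w *m x) <= c * dotv x x].
(* Integer vectors are enumerated by their codes; a number that is not a code
   imposes no condition. *)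
rewrite (_ : [set _ | _] = \bigcap_(k : nat)
    (if unpickle k is Some z then F z else setT)).
  apply: bigcapT_measurable => k; case: unpickle => [z|//].
  apply: measurable_le_set; last exact: measurable_cst.
  by apply: measurable_dotvv; apply: random_mxM => //; exact: random_mx_cst.
apply/seteqP; split=> w /= hw.
  by move=> k _; case: unpickle => // z; exact: hw.
apply: bounded_on_int => // z.
by have := hw (pickle z) I; rewrite pickleK.
Qed.

Lemma measurable_specnorm_le (R : realType) (disp : measure_display)
    (Omega : measurableType disp) (m n : nat) (X : Omega -> 'M[R]_(m, n))
    (c : R) : 0 <= c -> random_mx X ->
  measurable [set w | specnorm (X w) <= c].
Proof.
move=> c0 mX; rewrite (_ : [set _ | _] = [set w | forall x : 'cV[R]_n,
    dotv (X w *m x) (X w *m x) <= c ^+ 2 * dotv x x]).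
  by apply: measurable_bounded_mx => //; exact: sqr_ge0.
by apply/seteqP; split=> w /= /(specnorm_leP _ c0).
Qed.

Lemma probability_setC_le (R : realType) (disp : measure_display)
    (Omega : measurableType disp) (P : probability Omega R) (U : set Omega)
    (e : R) : measurable U ->
  ((1 - e)%:E <= P U)%E <-> (P (~` U) <= e%:E)%E.
Proof.
move=> mU; rewrite probability_setC//.
have : P U \is a fin_num by rewrite fin_num_measure.
case: (P U) => // r _; rewrite -EFinB !lee_fin; split; lra.
Qed.

(** What a step at x needs from S, with v = H (x - xs).  It is stated by
    polynomial inequalities in the entries of v and S, rather than by the
    sketching event of the matrix B that [sketch_witness] associates with v, in
    order to be jointly measurable in (v, S). *)
Definition sketch_good (R : realType) (d ell : nat) (H : 'M[R]_d) (c : R)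
    (v : 'cV[R]_d) (S : 'M[R]_(d, ell)) : Prop :=
  dotv (H *m v) (H *m v) / 4 <= dotv (S^T *m (H *m v)) (S^T *m (H *m v)) /\
  forall q : 'cV[R]_ell,
    dotv (H *m S *m q) (H *m S *m q) <= c * dotv q q.

Lemma measurable_sketch_good (R : realType) (disp : measure_display)
    (Omega : measurableType disp) (d ell : nat) (H : 'M[R]_d) (c : R)
    (V : Omega -> 'cV[R]_d) (S : Omega -> 'M[R]_(d, ell)) :
  0 <= c -> random_mx V -> random_mx S ->
  measurable [set w | sketch_good H c (V w) (S w)].
Proof.
move=> c0 mV mS; have mHV := random_mxM (random_mx_cst H) mV.
apply: measurableI.
  apply: measurable_le_set.
    by apply: measurable_funM; [exact: measurable_dotvv|exact: measurable_cst].
  by apply: measurable_dotvv; apply: random_mxM => //; exact: random_mx_tr.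
by apply: measurable_bounded_mx => //; exact: random_mxM.
Qed.

(** For a fixed iterate the sketching event of the matrix given by
    [sketch_witness] suffices; independence extends the bound to the random
    iterate. *)
Lemma sketch_good_probability (R : realType) (disp : measure_display)
    (Omega : measurableType disp) (P : probability Omega R) (d ell : nat)
    (H : 'M[R]_d) (k e : R) (xs : 'cV[R]_d) (X : Omega -> 'cV[R]_d)
    (S : Omega -> 'M[R]_(d, ell))
    (c := 5 * specnorm (H *m H) + \tr (H *m H) / k) :
  H^T = H -> (forall v : 'cV[R]_d, H *m v = 0 -> v = 0) -> 1 <= k ->
  0 <= c -> 0 <= e ->
  oblivious_sketching P (1 / 4) k e S -> random_mx X -> independent_mx P X S ->
  (P (~` [set w | sketch_good H c (H *m (X w - xs)) (S w)]) <= e%:E)%E.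
Proof.
move=> Hs inj k1 c0 e0 [mS hS] mX hXS.
pose bad : set (@mx_space R d 1%N * @mx_space R d ell) :=
  ~` [set p : @mx_space R d 1%N * @mx_space R d ell |
      sketch_good H c (H *m ((p.1 : 'cV[R]_d) - xs)) (p.2 : 'M[R]_(d, ell))].
apply: (independent_section_bound (X := X : Omega -> @mx_space R d 1%N)
  (Y := S : Omega -> @mx_space R d ell) (bad := bad)).
- exact: random_mxE.
- exact: random_mxE.
- exact: hXS.
- apply: measurableC; apply: measurable_sketch_good => //.
    apply: random_mxM; first exact: random_mx_cst.
    apply: random_mxB; last exact: random_mx_cst.
    move=> i j.
    apply: (measurableT_comp (f := fun M : @mx_space R d 1%N => M i j)) => //.
    exact: measurable_coordinate.
  move=> i j.
  apply: (measurableT_comp (f := fun M : @mx_space R d ell => M i j)) => //.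
  exact: measurable_coordinate.
- by rewrite lee_fin.
move=> u; have [B hB] := sketch_witness Hs k1 (inj (H *m (u - xs))).
set K := [set w | specnorm (B^T *m S w *m (S w)^T *m B - B^T *m B) <=
  1 / 4 * (specnorm B ^+ 2 + frobnorm B ^+ 2 / k)].
have mK : measurable K.
  apply: measurable_specnorm_le.
    by rewrite mulr_ge0// addr_ge0 ?sqr_ge0// divr_ge0 ?sqr_ge0// (le_trans ler01).
  have mB := random_mx_cst (B^T); have mB' := random_mx_cst B.
  apply: random_mxB; last exact: random_mx_cst.
  apply: random_mxM => //; apply: random_mxM; last exact: random_mx_tr.
  exact: random_mxM.
have /(probability_setC_le P e mK) := hS B; apply: le_trans.
apply: le_measure; rewrite ?inE.
- apply: measurableC; apply: measurable_sketch_good => //.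
  exact: (random_mx_cst (H *m (u - xs))).
- exact: measurableC.
- by move=> w /= nbad Kw; apply: nbad; exact: hB.
Qed.

(** * Number of iterations *)

(** nu / rho is the fixed point of the recursion. *)
Lemma affine_recursion (R : realType) (g : nat -> R) (rho nu : R) (T : nat) :
  0 < rho -> rho <= 1 ->
  (forall t, (t < T)%N -> g t.+1 <= (1 - rho) * g t + nu) -> 0 <= nu ->
  g T <= (1 - rho) ^+ T * g 0%N + nu / rho.
Proof.
move=> r0 r1 hg nu0.
have h0 : 0 <= nu / rho by rewrite divr_ge0// ltW.
suff h t : (t <= T)%N -> g t <= (1 - rho) ^+ t * g 0%N + nu / rho by exact: h.
elim: t => [_|t IH tT]; first by rewrite expr0 mul1r lerDl.
apply: le_trans (hg t tT) _.
have hr : 0 <= 1 - rho by rewrite subr_ge0.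
have := ler_wpM2l hr (IH (ltnW tT)); rewrite exprS mulrDr.
have -> : (1 - rho) * (nu / rho) = nu / rho - nu by field; rewrite gt_eqF.
rewrite mulrA; lra.
Qed.

(** 1 - rho <= exp (- rho). *)
Lemma geometric_le (R : realType) (rho g D eps : R) (T : nat) :
  0 <= rho <= 1 -> g <= D -> 0 < D -> 0 < eps ->
  ln D + ln (1 / eps) <= rho * T%:R -> (1 - rho) ^+ T * g <= eps.
Proof.
move=> /andP[r0 r1] gD D0 e0 hT.
have p0 : 0 <= (1 - rho) ^+ T by rewrite exprn_ge0// subr_ge0.
apply: (@le_trans _ _ ((1 - rho) ^+ T * D)); first by rewrite ler_wpM2l.
apply: (@le_trans _ _ (expR (- (rho * T%:R)) * D)).
  rewrite ler_pM2r// -mulNr mulrC expRM_natl lerXn2r ?nnegrE ?subr_ge0 ?expR_ge0//.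
  exact: expR_ge1Dx.
have -> : expR (- (rho * T%:R)) * D = expR (- (rho * T%:R) + ln D).
  by rewrite expRD lnK// posrE.
rewrite -[leRHS]lnK ?posrE// ler_expR.
by move: hT; rewrite lnM ?posrE ?invr_gt0// ln1 add0r lnV ?posrE//; lra.
Qed.

(** The contraction factor is 1 - eta mu / 4 with eta = 1 / (5 a + tr / k), so
    about 4 (5 a / mu + tr / (mu k)) (lD + l) iterations are needed.  Two
    comparisons bring this to the announced form: ell <= 2 c k gives
    tr / k <= 2 c tr / ell, and l0 <= l gives lD + l <= (1 + lD / l0) l. *)
Lemma iteration_count (R : realType) (a tr k mu c l l0 lD : R) (ell : nat)
    (T : R) :
  0 < mu -> mu <= a -> 0 <= tr -> 0 < k -> (0 < ell)%N ->
  ell%:R <= 2 * c * k -> 0 < c -> 0 < l0 -> l0 <= l -> 0 <= lD ->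
  4 * (5 + 2 * c) * (1 + lD / l0) * ((a / mu + tr / (mu * ell%:R)) * l) <= T ->
  lD + l <= (5 * a + tr / k)^-1 * mu / 4 * T.
Proof.
move=> mu0 mua tr0 k0 ell0 ellk c0 l00 ll lD0 hT.
have e0 : 0 < ell%:R :> R by rewrite ltr0n.
have a0 : 0 < a by apply: lt_le_trans mua.
have l0' : 0 < l by apply: lt_le_trans ll.
set M := 5 * a + tr / k.
have M0 : 0 < M by rewrite /M ltr_wpDr ?mulr_gt0// divr_ge0// ltW.
have hl : lD + l <= (1 + lD / l0) * l.
  rewrite mulrDl mul1r addrC lerD2l mulrAC ler_pdivlMr//.
  by rewrite ler_wpM2l.
have hM : M / mu <= (5 + 2 * c) * (a / mu + tr / (mu * ell%:R)).
  have h1 : tr / k <= 2 * c * (tr / ell%:R).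
    rewrite ler_pdivrMr// [leRHS](_ : _ = 2 * c * k * (tr / ell%:R)).
      apply: (@le_trans _ _ (ell%:R * (tr / ell%:R))).
        by rewrite mulrCA divff ?gt_eqF// mulr1.
      by rewrite ler_wpM2r// divr_ge0// ltW.
    by ring.
  have h2 : 0 <= tr / ell%:R by rewrite divr_ge0// ltW.
  have h3 : 0 <= c * a by rewrite mulr_ge0// ltW.
  rewrite [leRHS](_ : _ = (5 + 2 * c) * (a + tr / ell%:R) / mu); last first.
    by field; rewrite !gt_eqF.
  rewrite ler_pM2r ?invr_gt0// /M; lra.
have th0 : 0 <= 1 + lD / l0 by rewrite addr_ge0// divr_ge0// ltW.
have step : 4 * (M / mu) * (lD + l) <= T.
  apply: le_trans hT.
  have -> : 4 * (5 + 2 * c) * (1 + lD / l0) * ((a / mu + tr / (mu * ell%:R)) * l)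
    = 4 * ((5 + 2 * c) * (a / mu + tr / (mu * ell%:R))) * ((1 + lD / l0) * l).
    by ring.
  apply: ler_pM => //.
  - by rewrite mulr_ge0// divr_ge0// ltW.
  - by rewrite addr_ge0// ltW.
  - by rewrite ler_pM2l.
rewrite [leRHS](_ : _ = T / (4 * (M / mu))); last first.
  by field; rewrite !gt_eqF.
rewrite ler_pdivlMr; first by rewrite mulrC.
by rewrite mulr_gt0// divr_gt0.
Qed.

(** Rounding up costs at most one iteration, which the constant absorbs: since
    a / mu >= 1 and l >= l0, the factor of C under the ceiling is at least l0. *)
Lemma ceil_iterations (R : realType) (C a tr mu l l0 : R) (ell T : nat) :
  0 < mu -> mu <= a -> 0 <= tr -> (0 < ell)%N -> 0 < l0 -> l0 <= l ->
  T%:Z = Num.ceil (C * ((a / mu + tr / (mu * ell%:R)) * l)) ->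
  T%:R <= (C + l0^-1) * ((a / mu + tr / (mu * ell%:R)) * l) /\
  (T * ell)%N%:R <= (C + l0^-1) * ((ell%:R * a / mu + tr / mu) * l).
Proof.
move=> mu0 mua tr0 ell0 l00 ll hT.
have e0 : 0 < ell%:R :> R by rewrite ltr0n.
set X := (_ + _) * l in hT *.
have X1 : 1 <= l0^-1 * X.
  rewrite mulrC ler_pdivlMr// mul1r; apply: le_trans (ll) _.
  rewrite /X ler_peMl//; first exact: le_trans (ltW l00) ll.
  have : 1 <= a / mu by rewrite ler_pdivlMr// mul1r.
  have : 0 <= tr / (mu * ell%:R) by rewrite divr_ge0// mulr_ge0// ltW.
  lra.
have TX : T%:R <= (C + l0^-1) * X.
  have := ceilB1_lt (C * X); rewrite -hT intrB ltrBlDr => h.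
  rewrite mulrDl; apply: le_trans (ltW h) _; exact: lerD.
split=> //; rewrite natrM.
have -> : (C + l0^-1) * ((ell%:R * a / mu + tr / mu) * l)
  = (C + l0^-1) * X * ell%:R by rewrite /X; field; rewrite !gt_eqF.
by rewrite ler_pM2r.
Qed.

(** * Convergence of the method *)

(* c0 is the constant hidden in ell = O(k + log(T/delta)); Delta0 bounds the
   initial gap, which the O(.) for T treats as a constant; eps ranges over
   ]0, eps0] with eps0 < 1, so that log(1/eps) stays away from 0.  The constants
   C and C' depend on c0, Delta0 and eps0 only. *)
Theorem corollary1 (R : realType) (c0 Delta0 eps0 : R)
    (hc0 : 0 < c0) (heps0 : 0 < eps0) (heps01 : eps0 < 1) :
  exists C C' : R, 0 < C /\ 0 < C' /\
  forall (d ell T : nat) (hd : (0 < d)%N) (hell : (0 < ell)%N)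
    (A : 'M[R]_d) (L mu sigma alpha k delta eps : R)
    (phi f : 'cV[R]_d -> R) (xstar x0 : 'cV[R]_d)
    (disp : measure_display) (Omega : measurableType disp)
    (P : probability Omega R)
    (S : nat -> Omega -> 'M[R]_(d, ell)) (x : nat -> Omega -> 'cV[R]_d)
    (hphi : quadratic_with_hessian phi A)
    (hA0 : loewner_le 0 A) (hAL : loewner_le A (L *: 1%:M)) (hL : 0 < L)
    (hsc : strongly_convex mu phi) (hmu : 0 < mu)
    (hxstar : forall y, phi xstar <= phi y)
    (hf : forall y, `|f y - phi y| <= sigma) (hsigma : 0 <= sigma)
    (halpha : 0 < alpha)
    (hk : 1 <= k) (hdelta : 0 < delta)
    (heps : 0 < eps) (hepsle : eps <= eps0)
    (hgap : phi x0 - phi xstar <= Delta0)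
    (hS : forall t, (t < T)%N ->
       oblivious_sketching P (1 / 4) k (delta / T%:R) (S t))
    (hellO : ell%:R <= c0 * (k + ln (T%:R / delta)))
    (hkT : ln (T%:R / delta) < k)
    (hx0 : forall w, x 0%N w = x0)
    (hxS : forall t, (t < T)%N -> forall w,
       x t.+1 w = zo_step f alpha (step_size A k) (S t w) (x t w))
    (hxm : forall t, (t <= T)%N -> random_mx (x t))
    (hind : forall t, (t < T)%N -> independent_mx P (x t) (S t))
    (hT : C * ((specnorm A / mu + \tr A / (mu * ell%:R)) * ln (1 / eps))
            <= T%:R),
    ((1 - delta)%:E <=
      P [set w | (phi (x T w) - phi xstar <=
                  eps + 3 * ell%:R * sigma ^+ 2 / (mu * alpha ^+ 2))%R])%E /\
    (T%:Z = Num.ceil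
        (C * ((specnorm A / mu + \tr A / (mu * ell%:R)) * ln (1 / eps))) ->
     T%:R <= C' * ((specnorm A / mu + \tr A / (mu * ell%:R)) * ln (1 / eps)) /\
     (T * ell)%N%:R <=
       C' * ((ell%:R * specnorm A / mu + \tr A / mu) * ln (1 / eps))).
Proof.
pose D := Num.max 1 Delta0; pose l0 := ln (1 / eps0).
have D1 : 1 <= D by rewrite le_max lexx.
have lD0 : 0 <= ln D by exact: ln_ge0.
have l00 : 0 < l0 by rewrite /l0 ln_gt0// div1r invf_gt1.
pose C := 4 * (5 + 2 * c0) * (1 + ln D / l0).
have C0 : 0 < C.
  rewrite /C mulr_gt0//; first by rewrite mulr_gt0// addr_gt0// mulr_gt0.
  by rewrite ltr_pwDl// divr_ge0// ltW.
exists C, (C + l0^-1); split=> //; split; first by rewrite addr_gt0// invr_gt0.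
move=> d ell T hd hell A L mu sigma alpha k delta eps phi f xs x0 disp Omega P
  S x hphi hA0 hAL hL hsc hmu hxstar hf hsigma halpha hk hdelta heps hepsle
  hgap hS hellO hkT hx0 hxS hxm hind hT.
have [H [Hs HA phiE Hmu]] := quadratic_root hd hphi hsc hmu hxstar.
have k0 : 0 < k by apply: lt_le_trans hk.
have e0 : 0 < ell%:R :> R by rewrite ltr0n.
have tr0 : 0 <= \tr A by rewrite -HA -{2}Hs -frobnorm_sqr sqr_ge0.
have mua : mu <= specnorm A.
  pose z : 'cV[R]_d := delta_mx (Ordinal hd) 0.
  have z0 : 0 < dotv z z.
    rewrite lt_neqAle dotvv_ge0 andbT eq_sym; apply/eqP.
    move=> /dotvv_eq0 /colP /(_ (Ordinal hd)); rewrite !mxE !eqxx /=.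
    by move/eqP; rewrite oner_eq0.
  rewrite -(ler_pM2r z0); apply: le_trans (Hmu z) _.
  by rewrite -HA; exact: dotv_sqr_specnorm.
have ll : l0 <= ln (1 / eps).
  by rewrite ler_ln ?posrE ?divr_gt0// !div1r lef_pV2.
split; last exact: ceil_iterations.
pose M := 5 * specnorm A + \tr A / k.
have M5 : 5 * mu <= M.
  have : 0 <= \tr A / k by rewrite divr_ge0// ltW.
  rewrite /M; lra.
have M0 : 0 < M by apply: lt_le_trans M5; rewrite mulr_gt0.
pose rho := M^-1 * mu / 4.
have rho0 : 0 < rho by rewrite divr_gt0// mulr_gt0// invr_gt0.
have rho1 : rho <= 1.
  by rewrite /rho ler_pdivrMr// mul1r mulrC ler_pdivrMr//; lra.
pose nz := ell%:R * sigma ^+ 2 / alpha ^+ 2.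
have nz0 : 0 <= nz by rewrite divr_ge0 ?sqr_ge0// mulr_ge0 ?sqr_ge0// ltW.
have inj (v : 'cV[R]_d) : H *m v = 0 -> v = 0.
  move=> Hv; apply: dotvv_eq0; apply/eqP; rewrite eq_le dotvv_ge0 andbT.
  by have := Hmu v; rewrite Hv dotv0r pmulr_rle0.
have hrate : (1 - rho) ^+ T * (phi x0 - phi xs) <= eps.
  apply: (@geometric_le _ _ _ D) => //.
  - by rewrite ltW.
  - by rewrite le_max hgap orbT.
  - exact: lt_le_trans D1.
  - apply: (iteration_count (c := c0) (l0 := l0) (ell := ell)) => //.
    have : c0 * (k + ln (T%:R / delta)) <= c0 * (k + k).
      by rewrite ler_pM2l// lerD2l ltW.
    by lra.
(* The argument below is pathwise: randomness enters only through the events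
   sketch_good. *)
have final w : (forall t, (t < T)%N ->
    sketch_good H M (H *m (x t w - xs)) (S t w)) ->
    phi (x T w) - phi xs <=
      eps + 3 * ell%:R * sigma ^+ 2 / (mu * alpha ^+ 2).
  move=> good; pose g t := phi (x t w) - phi xs.
  have rec t : (t < T)%N -> g t.+1 <= (1 - rho) * g t + M^-1 / 2 * nz.
    move=> tT; have [hlow hup] := good t tT.
    rewrite /g (hxS _ tT) /step_size -/M /rho.
    by apply: (zo_step_contraction (H := H)); rewrite ?invr_gt0// invrK.
  have nu0 : 0 <= M^-1 / 2 * nz by rewrite mulr_ge0// divr_ge0// invr_ge0 ltW.
  have := affine_recursion rho0 rho1 rec nu0; rewrite /g hx0.
  (* The fixed point of the recursion has the constant 2, below the bound 3. *)
  have -> : M^-1 / 2 * nz / rho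
      = 2 * (ell%:R * sigma ^+ 2 / (mu * alpha ^+ 2)).
    by rewrite /rho /nz; field; rewrite !gt_eqF.
  have : 0 <= ell%:R * sigma ^+ 2 / (mu * alpha ^+ 2).
    by rewrite divr_ge0 ?mulr_ge0 ?sqr_ge0// ltW.
  have -> : 3 * ell%:R * sigma ^+ 2 / (mu * alpha ^+ 2)
    = 3 * (ell%:R * sigma ^+ 2 / (mu * alpha ^+ 2)) by ring.
  lra.
have mfinal : measurable [set w | phi (x T w) - phi xs <=
    eps + 3 * ell%:R * sigma ^+ 2 / (mu * alpha ^+ 2)].
  under eq_set => w do rewrite (phiE (x T w)) [phi xs + _]addrC addrK.
  apply: measurable_le_set; last exact: measurable_cst.
  apply: measurable_funM; first exact: measurable_cst.
  apply: measurable_dotvv; apply: random_mxM; first exact: random_mx_cst.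
  by apply: random_mxB; [exact: hxm|exact: random_mx_cst].
apply/probability_setC_le => //.
pose bad t := ~` [set w | sketch_good H M (H *m (x t w - xs)) (S t w)].
have mbad t : (t < T)%N -> measurable (bad t).
  move=> tT; apply: measurableC; apply: measurable_sketch_good.
  - exact: ltW.
  - apply: random_mxM; first exact: random_mx_cst.
    by apply: random_mxB; [apply: hxm; exact: ltnW|exact: random_mx_cst].
  - by have [] := hS t tT.
apply: (@le_trans _ _ (P (\big[setU/set0]_(t < T) bad t))).
  apply: le_measure; rewrite ?inE.
  - exact: measurableC.
  - by apply: bigsetU_measurable => t _; exact: mbad.
  - move=> w /= nfin; rewrite -bigcup_mkord.
    apply: contrapT => nbad; apply: nfin; apply: final => t tT.
    by apply: contrapT => nb; apply: nbad; exists t.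
apply: le_trans (Boole_inequality _ _) _ => //.
apply: (@le_trans _ _ (\sum_(t < T) (delta / T%:R)%:E)%E).
  apply: lee_sum => t _; rewrite /bad /M -HA.
  apply: sketch_good_probability => //.
  - by rewrite HA ltW.
  - by rewrite divr_ge0// ltW.
  - exact: hS.
  - by apply: hxm; exact: ltnW.
  - exact: hind.
rewrite sumEFin sumr_const card_ord lee_fin -[_ / _ *+ T]mulr_natr.
have [->|Tn0] := eqVneq T 0%N; first by rewrite mulr0 ltW.
by rewrite divfK// pnatr_eq0.
Qed.
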